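(* For every even integer $n\geq 4$, we have $r_{\mathrm{odd}}\left(n,\frac n2+4;C_n\right)\geq 3$. That is, for every graph $G$ on $n$ vertices with minimum degree at least $\frac n2+4$, we have $r_{\mathrm{odd}}(G,C_n)\ge 3$.
   Context: Graphs are finite and simple; $v(G)$ and $\delta(G)$ denote the number of vertices and minimum degree of $G$. For graphs $G,H$, the odd-Ramsey number $r_{\mathrm{odd}}(G,H)$ is the minimum positive integer $r$ for which there is an edge-colouring of $G$ with $r$ colours (not required to be proper) such that every copy of $H$ in $G$ contains an odd number of edges of at least one colour. $C_n$ is the cycle on $n$ vertices. Define $r_{\mathrm{odd}}(n,\delta;C_n)=\min\{r_{\mathrm{odd}}(G,C_n): v(G)=n,\ \delta(G)\ge\delta\}$, where the minimum over the empty set is taken to be $+\infty$ (relevant only for $n<10$). *)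

(* Defs.v *)
From mathcomp Require Import all_boot.
From mathcomp Require Import boolp.

Set Implicit Arguments.
Unset Strict Implicit.
Unset Printing Implicit Defensive.

(* Natural numbers extended with +oo: [None] stands for +oo. *)
Definition enat : Type := option nat.

Definition enat_le (x y : enat) : bool :=
  match x, y with
  | _, None => true
  | None, Some _ => false
  | Some a, Some b => a <= b
  end.

(* Minimum of a set of extended naturals; it is +oo on the empty set. *)
Definition enat_min (A : enat -> Prop) : enat :=
  match pselect (exists k : nat, `[< A (Some k) >]) with
  | left h => Some (ex_minn h)
  | right _ => None
  end.

Record sgraph : Type := SGraph {
  vertex :> finType;
  adj : rel vertex;
  adj_sym : symmetric adj;
  adj_irrefl : irreflexive adj
}.

Definition edges (G : sgraph) : {set {set G}} :=
  [set [set p.1; p.2] | p : G * G & adj p.1 p.2].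

Definition degree (G : sgraph) (x : G) : nat := #|[set y : G | adj x y]|.

(* The neutral value #|G| exceeds every degree, so it does not affect the
   minimum unless G has no vertices. *)
Definition min_degree (G : sgraph) : nat :=
  \big[minn/#|G|]_(x : G) degree x.

(* (V, F) is a copy of H in G: a subgraph of G, with vertex set V and edge
   set F, that is isomorphic to H through f. *)
Definition is_copy (H G : sgraph) (V : {set G}) (F : {set {set G}}) : Prop :=
  F \subset edges G /\
  exists f : H -> G,
    [/\ injective f, V = f @: [set: H]
      & F = [set f @: (e : {set H}) | e in edges H]].

(* A colouring assigns a colour to every set of vertices, but only the
   colours of edges of G matter. *)
Definition odd_colouring (G H : sgraph) (r : nat) (c : {set G} -> 'I_r) : Prop :=
  forall (V : {set G}) (F : {set {set G}}), is_copy H V F ->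
    exists i : 'I_r, odd #|[set e in F | c e == i]|.

(* The value is +oo when no number of colours works, which happens only if H
   has no edges and G contains a copy of H. *)
Definition r_odd (G H : sgraph) : enat :=
  enat_min (fun k : enat => exists r : nat,
    [/\ k = Some r, 0 < r & exists c : {set G} -> 'I_r, odd_colouring H c]).

Definition r_odd_min (n d : nat) (H : sgraph) : enat :=
  enat_min (fun k : enat => exists G : sgraph,
    [/\ #|G| = n, d <= min_degree G & k = r_odd G H]).

(* [ordS] is the cyclic successor on 'I_n. The disequality only excludes the
   loop that would appear for n = 1; this is C_n for n >= 3. *)
Definition cycle_adj (n : nat) : rel 'I_n :=
  fun i j => (i != j) && ((j == ordS i) || (i == ordS j)).

Lemma cycle_adj_sym (n : nat) : symmetric (@cycle_adj n).
Proof. by move=> i j; rewrite /cycle_adj eq_sym orbC. Qed.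

Lemma cycle_adj_irrefl (n : nat) : irreflexive (@cycle_adj n).
Proof. by move=> i; rewrite /cycle_adj eqxx. Qed.

Definition cycle_graph (n : nat) : sgraph :=
  SGraph (@cycle_adj_sym n) (@cycle_adj_irrefl n).

(* Main.v *)
(** With at most two colours and n even, an odd colouring makes every Hamilton
    cycle use colour 0 an odd number of times, so it suffices to find a
    Hamilton cycle on which the weight b (the indicator of colour 0) is even.
    A graph whose minimum degree exceeds half its order is Hamilton-connected,
    and this survives the deletion of up to seven vertices from G.  Hence two
    paths with the same ends and the same (few) inner vertices but b-weights of
    different parity extend to two Hamilton cycles, one of which is even.  Such
    a pair of paths can be built around every 4-cycle and every 6-cycle of odd
    weight.  If all 4-cycles and 6-cycles are even, then
    g(x, y) = b(xp) + b(py) mod 2 does not depend on the common neighbour p and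
    satisfies g(x, y) + g(y, z) = g(x, z), so every closed walk of even length
    is even, in particular every Hamilton cycle. *)
Require Import Defs.
From mathcomp Require Import all_boot zify boolp.

Set Implicit Arguments.
Unset Strict Implicit.
Unset Printing Implicit Defensive.

(** * Weights of walks and segment reversal *)

Section Walks.
Variable T : eqType.
Implicit Types (r e : rel T) (x y u : T) (s : seq T).

(** The walk is [x :: s], and its steps related by [r] are counted. With [r] the non-adjacency
    relation these are the gaps of a vertex ordering; with [r] a colour class it is the weight whose
    parity matters. *)
Definition wt r x s := count id (pairmap r x s).

Lemma wt_cons r x y s : wt r x (y :: s) = r x y + wt r y s.
Proof. by []. Qed.

Lemma wt_cat r x s1 s2 : wt r x (s1 ++ s2) = wt r x s1 + wt r (last x s1) s2.
Proof. by rewrite /wt pairmap_cat count_cat. Qed.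

Lemma last_rev_belast x s : last (last x s) (rev (belast x s)) = x.
Proof. by case: s => //= y s; rewrite rev_cons last_rcons. Qed.

Lemma wt_rev r x s : symmetric r -> wt r (last x s) (rev (belast x s)) = wt r x s.
Proof.
move=> r_sym; elim: s x => //= y s IHs x.
rewrite rev_cons -cats1 wt_cat IHs last_rev_belast !wt_cons r_sym.
by rewrite addn0 addnC.
Qed.

Lemma wt_eq0_path e x s :
  (wt (fun a b => ~~ e a b) x s == 0) = path e x s.
Proof. by elim: s x => //= y s IHs x; rewrite wt_cons addn_eq0 IHs; case: (e x y). Qed.

(* The new walk reverses the segment of s from index a to index b - 1. *)
Lemma two_opt e u s a b :
    symmetric e -> a < b < size s ->
    e (nth u (u :: s) a) (nth u (u :: s) b) -> e (nth u s a) (nth u s b) ->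
    ~~ (e (nth u (u :: s) a) (nth u s a) && e (nth u (u :: s) b) (nth u s b)) ->
  exists s', [/\ perm_eq s' s, last u s' = last u s
    & wt (fun x y => ~~ e x y) u s' < wt (fun x y => ~~ e x y) u s].
Proof.
move=> e_sym /andP[ltab ltbs].
have [s1 [y [s2 [t [s3 [-> <- ->]]]]]] : exists s1 y s2 t s3,
    [/\ s = s1 ++ y :: s2 ++ t :: s3, size s1 = a & b = (size (s1 ++ s2)).+1].
  exists (take a s), (nth u s a), (take (b - a.+1) (drop a.+1 s)), (nth u s b).
  exists (drop b.+1 s); split.
  - rewrite -[LHS](cat_take_drop a); congr (_ ++ _).
    rewrite (drop_nth u) ?(ltn_trans ltab) //; congr (_ :: _).
    rewrite -[LHS](cat_take_drop (b - a.+1)) drop_drop subnK //.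
    by rewrite (drop_nth u ltbs).
  - by rewrite size_takel // ltnW // (ltn_trans ltab).
  - by rewrite size_cat !size_take_min size_drop; lia.
have nth_pre w l l' : nth u (u :: l ++ w :: l') (size l) = last u l.
  by rewrite -cat_cons nth_cat /= ltnSn -[size l]/(size (u :: l)).-1 nth_last.
have nth_mid w l l' : nth u (l ++ w :: l') (size l) = w.
  by rewrite nth_cat ltnn subnn.
have -> : s1 ++ y :: s2 ++ t :: s3 = (s1 ++ y :: s2) ++ t :: s3 by rewrite -catA.
have -> : (size (s1 ++ s2)).+1 = size (s1 ++ y :: s2).
  by rewrite !size_cat /= addnS.
rewrite !nth_pre !nth_mid -catA cat_cons nth_pre nth_mid last_cat /= => exz eyt gap.
exists (s1 ++ rev (y :: s2) ++ t :: s3); split.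
- by rewrite perm_cat2l -cat_cons perm_cat2r perm_rev.
- by rewrite !last_cat /= last_cat.
rewrite (lastI y) rev_rcons !(wt_cat, wt_cons) /=.
rewrite last_rev_belast wt_rev; last by move=> x x'; rewrite e_sym.
by move: gap; rewrite exz eyt /=; do 2 case: (e _ _) => //=; lia.
Qed.

End Walks.

(** * Hamilton-connectedness from large minimum degree *)

Section Hamilton.
Variables (T : finType) (e : rel T).
Hypotheses (e_sym : symmetric e) (e_irr : irreflexive e).

(** Ore's counting argument: for a gap [x], [y], the degrees sum to more than [#|W|], so some other
    step of the ordering starts at a neighbour of [x] and ends at a neighbour of [y]. Reversing the
    segment between the two steps removes the gap, creates none and keeps both ends. *)
Lemma reduce_gaps (W : {set T}) u s :
    (forall x, x \in W -> #|W| < 2 * #|[set y in W | e x y]|) ->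
    perm_eq (u :: s) (enum W) -> 0 < wt (fun x y => ~~ e x y) u s ->
  exists s', [/\ perm_eq (u :: s') (enum W), last u s' = last u s
    & wt (fun x y => ~~ e x y) u s' < wt (fun x y => ~~ e x y) u s].
Proof.
move=> degW permW; rewrite -has_count => /(hasP) [g /(nthP true)].
rewrite size_pairmap => -[i lt_i <-]; rewrite (nth_pairmap u) // => gap.
have memW x : (x \in W) = (x \in u :: s) by rewrite (perm_mem permW) mem_enum.
have cardW : #|W| = (size s).+1 by rewrite cardE -(perm_size permW).
set x := nth u (u :: s) i in gap *; set y := nth u s i in gap *.
have xW : x \in W by rewrite memW mem_nth // ltnW.
have yW : y \in W by rewrite memW inE mem_nth ?orbT.
pose A := [set j : 'I_(size s) | e x (nth u (u :: s) j)].
pose B := [set j : 'I_(size s) | e y (nth u s j)].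
(* One neighbour may be lost: the last vertex starts no step. Likewise [u] ends no step in the bound
   for [B]. *)
have leA : #|[set z in W | e x z]| <= #|A|.+1.
  apply: (@leq_trans (#|last u s |: [set nth u (u :: s) (j : 'I_(size s)) | j in A]|)).
    apply: subset_leq_card; apply/subsetP => z; rewrite !inE memW => /andP[/(nthP u)[k]].
    rewrite /= ltnS leq_eqVlt => /orP[/eqP-> <- _|lt_k <- exz].
      by rewrite -[size s]/(size (u :: s)).-1 nth_last eqxx.
    by apply/orP; right; apply/imsetP; exists (Ordinal lt_k); rewrite ?inE.
  by rewrite cardsU1 -add1n leq_add ?leq_b1 ?leq_imset_card.
have leB : #|[set z in W | e y z]| <= #|B|.+1.
  apply: (@leq_trans (#|u |: [set nth u s (j : 'I_(size s)) | j in B]|)).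
    apply: subset_leq_card; apply/subsetP => z; rewrite !inE memW inE.
    case/andP=> /orP[-> //|/(nthP u)[k lt_k <-] eyz].
    by apply/orP; right; apply/imsetP; exists (Ordinal lt_k); rewrite ?inE.
  by rewrite cardsU1 -add1n leq_add ?leq_b1 ?leq_imset_card.
(* The gap's own index [i] lies in neither set, since [e] is irreflexive. *)
have leU : #|A :|: B| < size s.
  rewrite -[X in _ < X]card_ord -cardsT; apply/proper_card/properP.
  by split; [apply/subsetP | exists (Ordinal lt_i); rewrite ?inE ?e_irr].
have: 0 < #|A :&: B|.
  have := cardsUI A B; have := degW x xW; have := degW y yW; lia.
case/card_gt0P=> j; rewrite !inE => /andP[exj eyj].
have [s' [perm_s' last_s' lt_s']] : exists s', [/\ perm_eq s' s, last u s' = last u s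
    & wt (fun x y => ~~ e x y) u s' < wt (fun x y => ~~ e x y) u s].
  case: (ltngtP i j) => ij.
  - by apply: (two_opt (a := i) (b := j)); rewrite ?ij /= ?negb_and ?gap.
  - apply: (two_opt (a := j) (b := i)); rewrite ?ij /= ?negb_and ?gap ?orbT //.
      by rewrite e_sym.
    by rewrite e_sym.
  - by move: exj; rewrite -ij e_irr.
by exists s'; split => //; apply: perm_trans permW; rewrite perm_cons.
Qed.

Lemma hamilton_connected (W : {set T}) u v :
    (forall x, x \in W -> #|W| < 2 * #|[set y in W | e x y]|) ->
    u \in W -> v \in W -> u != v ->
  exists s, path e u (rcons s v) /\ perm_eq (u :: rcons s v) (enum W).
Proof.
move=> degW uW vW neq_uv.
suff [s [pW lv ps]] : exists s, [/\ perm_eq (u :: s) (enum W), last u s = v & path e u s].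
  case: (lastP s) lv ps pW => [/= uv|s' w]; first by rewrite uv eqxx in neq_uv.
  by rewrite last_rcons => ->; exists s'.
(* Start from any ordering of [W] from [u] to [v], then remove gaps until none is left. *)
have [s [pW lv]] : exists s, perm_eq (u :: s) (enum W) /\ last u s = v.
  exists (rcons (rem v (rem u (enum W))) v); rewrite last_rcons; split=> //.
  have uE: u \in enum W by rewrite mem_enum.
  have vE: v \in rem u (enum W).
    by rewrite mem_rem_uniq ?enum_uniq // inE eq_sym neq_uv mem_enum.
  rewrite perm_sym (perm_trans (perm_to_rem uE)) // perm_cons.
  by rewrite (perm_trans (perm_to_rem vE)) // perm_sym perm_rcons.
have [k le_k] := ubnP (wt (fun x y => ~~ e x y) u s).
elim: k => // k IHk in s pW lv le_k *.
case: (posnP (wt (fun x y => ~~ e x y) u s)) => [/eqP|gt0].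
  by rewrite wt_eq0_path; exists s.
have [s' [pW' lv' lt']] := reduce_gaps degW pW gt0.
by apply: (IHk s'); rewrite ?lv' //; lia.
Qed.

(** * Switching the parity of Hamilton cycles *)

Variable b : rel T.
Hypothesis b_sym : symmetric b.
Hypothesis deg_big : forall x, #|T| + 8 <= 2 * #|[set y | e x y]|.

Definition even_hamilton (c : seq T) :=
  if c is x :: s then
    [&& cycle e c, uniq c, size c == #|T| & ~~ odd (wt b x (rcons s x))]
  else false.

(** A Hamilton path from [v] to [u] outside the k inner vertices closes both paths. It exists
    because twice a degree there is at least [#|T|] + 8 - 2k, which exceeds [#|T|] - k exactly when
    k is at most 7. *)
Lemma parity_switch u v s1 s2 :
    uniq [:: u, v & s1] -> size s1 <= 7 -> perm_eq s1 s2 ->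
    path e u (rcons s1 v) -> path e u (rcons s2 v) ->
    odd (wt b u (rcons s1 v)) != odd (wt b u (rcons s2 v)) ->
  exists c, even_hamilton c.
Proof.
rewrite /= inE negb_or -andbA => /and4P[neq_uv us1 vs1 Us1] le7 p12 path1 path2 neq.
pose W := ~: [set x in s1].
have [k Dk] : exists k, size s1 = k by exists (size s1).
rewrite Dk in le7.
have cardS : #|[set x in s1]| = k by rewrite -Dk; rewrite cardsE; apply/card_uniqP.
have cardW : #|W| + k = #|T|.
  by rewrite -cardS addnC cardsC.
have degW x : x \in W -> #|W| < 2 * #|[set y in W | e x y]|.
  move=> _; have: #|[set y | e x y]| <= #|[set y in W | e x y]| + k.
    rewrite -cardS -[X in X <= _](cardsID [set y in s1]) addnC leq_add //.
      by apply: subset_leq_card; apply/subsetP => y; rewrite !inE.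
    by apply: subset_leq_card; apply/subsetP => y; rewrite !inE => /andP[].
  have := deg_big x; lia.
have [|||s [path_s perm_s]] := @hamilton_connected W v u degW.
- by rewrite !inE.
- by rewrite !inE.
- by rewrite eq_sym.
have mk s0 : perm_eq s1 s0 -> path e u (rcons s0 v) ->
    ~~ odd (wt b u (rcons s0 v) + wt b v (rcons s u)) -> exists c, even_hamilton c.
  move=> p10 path0 ev; exists (u :: s0 ++ v :: s) => /=.
  have permT : perm_eq (u :: s0 ++ v :: s) (s1 ++ enum W).
    rewrite -[u :: s0 ++ _]/([:: u] ++ (s0 ++ v :: s)) perm_catCA.
    rewrite perm_sym perm_cat // perm_sym (perm_trans _ perm_s) //=.
    by rewrite perm_sym -rcons_cons perm_rcons.
  have -> : rcons (s0 ++ v :: s) u = rcons s0 v ++ rcons s u.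
    by rewrite cat_rcons rcons_cat.
  rewrite cat_path last_rcons path0 path_s wt_cat last_rcons ev andbT /=.
  rewrite -[(size _).+1]/(size (u :: s0 ++ v :: s)) (perm_size permT).
  rewrite size_cat Dk -cardE addnC cardW eqxx !andbT.
  rewrite -[_ && _]/(uniq (u :: s0 ++ v :: s)) (perm_uniq permT).
  rewrite cat_uniq Us1 enum_uniq andbT /=.
  by apply/hasPn => x; rewrite mem_enum !inE.
case ev: (odd (wt b u (rcons s1 v) + wt b v (rcons s u))); last first.
  by apply: (mk s1); rewrite ?ev.
apply: (mk s2) => //; move: ev neq; rewrite !oddD.
by do 3 case: (odd _).
Qed.

(** The two neighbourhoods have total size at least [#|T|] + 8, so they share at least 8
    vertices. *)
Lemma common_neighbour x y (l : seq T) : size l < 8 ->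
  exists p, [/\ e x p, e p y & p \notin l].
Proof.
move=> lt8; pose A := [set z | e x z]; pose B := [set z | e y z].
have: 0 < #|(A :&: B) :\: [set z in l]|.
  have := cardsUI A B; have := max_card (A :|: B).
  have := cardsID [set z in l] (A :&: B).
  have: #|A :&: B :&: [set z in l]| <= size l.
    rewrite (leq_trans _ (card_size l)) // -cardsE subset_leq_card //.
    by apply/subsetP => z; rewrite !inE => /andP[].
  have := deg_big x; have := deg_big y; rewrite -/A -/B; lia.
case/card_gt0P=> p; rewrite !inE => /andP[pl /andP[exp eyp]].
by exists p; rewrite [e p y]e_sym.
Qed.

Lemma edge_neq x y : e x y -> x != y.
Proof. by apply: contraTneq => ->; rewrite e_irr. Qed.

Lemma even_square x p y q : ~ (exists c, even_hamilton c) ->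
    e x p -> e p y -> e x q -> e q y ->
  b x p (+) b p y = b x q (+) b q y.
Proof.
move=> nH exp epy exq eqy.
have [->|xy] := eqVneq x y; first by rewrite ![b _ y]b_sym !addbb.
have [->//|pq] := eqVneq p q.
(* The paths x p w q y and x q w p y share the edges at [w]; their other edges form the square. *)
have [w [epw ewq]] := @common_neighbour p q [:: x; y] isT.
rewrite !inE negb_or => /andP[wx wy].
apply/eqP/negPn/negP => neq; apply: nH.
apply: (@parity_switch x y [:: p; w; q] [:: q; w; p]) => //=.
- rewrite !inE !negb_or xy pq (edge_neq exp) (edge_neq exq) (edge_neq epw) (edge_neq ewq).
  by rewrite eq_sym wx ![y == _]eq_sym wy (edge_neq epy) (edge_neq eqy).
- by rewrite -[[:: q; w; p]]/(rev [:: p; w; q]) perm_sym perm_rev.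
- by rewrite exp epw ewq eqy.
- by rewrite exq e_sym ewq e_sym epw epy.
rewrite /wt /= !oddD !oddb (b_sym q w) (b_sym w p).
by move: neq; do 6 case: (b _ _).
Qed.

Lemma even_hexagon x0 x1 x2 x3 x4 x5 : ~ (exists c, even_hamilton c) ->
    uniq [:: x0; x1; x2; x3; x4; x5] ->
    e x0 x1 -> e x1 x2 -> e x2 x3 -> e x3 x4 -> e x4 x5 -> e x5 x0 ->
  b x0 x1 (+) b x1 x2 (+) b x2 x3 (+) b x3 x4 (+) b x4 x5 (+) b x5 x0 = false.
Proof.
move=> nH U e01 e12 e23 e34 e45 e50.
(* The two paths from [x0] to [x2] share the detours x1 s x4 and x5 t x3; their other edges are
   three alternate sides of the hexagon each. *)
have [s [e1s es4 sN]] := @common_neighbour x1 x4 [:: x0; x1; x2; x3; x4; x5] isT.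
have [t [e5t et3 tN]] := @common_neighbour x5 x3 [:: s; x0; x1; x2; x3; x4; x5] isT.
apply/negbTE/negP => odd6; apply: nH.
apply: (@parity_switch x0 x2 [:: x1; s; x4; x5; t; x3] [:: x5; t; x3; x4; s; x1]).
- have: uniq (t :: s :: [:: x0; x1; x2; x3; x4; x5]) by rewrite cons_uniq tN cons_uniq sN U.
  congr (is_true _); apply: perm_uniq.
  by apply/permP => P /=; do 8 move: (nat_of_bool (P _)) => ?; clear; lia.
- by [].
- by apply/permP => P /=; do 6 move: (nat_of_bool (P _)) => ?; clear; lia.
- by rewrite /= e01 e1s es4 e45 e5t et3 e_sym e23.
- by rewrite /= e_sym e50 e5t et3 e34 e_sym es4 e_sym e1s e12.
rewrite /wt /= !oddD !oddb (b_sym x4 s) (b_sym s x1) (b_sym x3 x2) (b_sym x0 x5).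
by move: odd6; do 10 case: (b _ _).
Qed.

Lemma exists_even_hamilton : 0 < #|T| -> ~~ odd #|T| -> exists c, even_hamilton c.
Proof.
move=> T_gt0 T_even; apply: contrapT => nH.
(* The default is never reached, as any two vertices have a common neighbour. *)
pose g x y := if [pick p | e x p && e p y] is Some p then b x p (+) b p y else false.
have gE x y p : e x p -> e p y -> b x p (+) b p y = g x y.
  move=> exp epy; rewrite /g; case: pickP => [q /andP[exq eqy]|/(_ p)].
    exact: even_square.
  by rewrite exp epy.
have gxx x : g x x = false.
  have [p [exp epx _]] := @common_neighbour x x [::] isT.
  by rewrite -(gE x x p) // b_sym addbb.
have g_sym x y : g x y = g y x.
  have [p [exp epy _]] := @common_neighbour x y [::] isT.
  by rewrite -(gE x y p) // -(gE y x p) 1?e_sym // addbC (b_sym y) (b_sym x).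
have gD x y z : g x y (+) g y z = g x z.
  have [->|xy] := eqVneq x y; first by rewrite gxx.
  have [->|yz] := eqVneq y z; first by rewrite gxx addbF.
  have [->|xz] := eqVneq x z; first by rewrite g_sym addbb gxx.
  (* Distinct midpoints turn the three values of [g] into the sides of a hexagon x p y q z r. *)
  have [p [exp epy pN]] := @common_neighbour x y [:: x; y; z] isT.
  have [q [eyq eqz qN]] := @common_neighbour y z [:: p; x; y; z] isT.
  have [r [ezr erx rN]] := @common_neighbour z x [:: q; p; x; y; z] isT.
  have exr : e x r by rewrite e_sym.
  have erz : e r z by rewrite e_sym.
  rewrite -(gE x y p) // -(gE y z q) // -(gE x z r) // (b_sym x r) (b_sym r z).
  have : uniq [:: x; p; y; q; z; r].
    have: uniq [:: r; q; p; x; y; z].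
      by rewrite cons_uniq rN cons_uniq qN cons_uniq pN /= !inE negb_or xy xz yz.
    congr (is_true _); apply: perm_uniq.
    by apply/permP => P /=; do 6 move: (nat_of_bool (P _)) => ?; clear; lia.
  by move/(even_hexagon nH)/(_ exp epy eyq eqz ezr erx); do 6 case: (b _ _).
have g_walk k : forall x s, size s = k.*2 -> path e x s ->
    odd (wt b x s) = g x (last x s).
  elim: k => [|k IHk] x [|p [|y s]] //=.
  move=> [sz] /and3P[exp epy ps].
  by rewrite !wt_cons !oddD !oddb (IHk y) // addbA (gE x y) // gD.
have [u _] : exists u, u \in T by apply/card_gt0P.
have [v [euv _ _]] := @common_neighbour u u [::] isT.
(* The edge from [u] to [v] closes this path into a Hamilton cycle, an even closed walk of parity
   [g u u]. *)
have [||||s [path_s perm_s]] := @hamilton_connected setT v u.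
- move=> x _; rewrite cardsT.
  have -> : [set y in setT | e x y] = [set y | e x y] by apply/setP => y; rewrite !inE.
  have := deg_big x; lia.
- by rewrite inE.
- by rewrite inE.
- by rewrite eq_sym edge_neq.
have sz : size (u :: v :: s) = #|T|.
  by rewrite -cardsT cardE -(perm_size perm_s) /= size_rcons.
apply: nH; exists (u :: v :: s); rewrite /even_hamilton sz eqxx /=.
rewrite euv path_s /=; apply/andP; split.
  have: uniq (v :: rcons s u) by rewrite (perm_uniq perm_s) enum_uniq.
  by rewrite -rcons_cons rcons_uniq.
rewrite (@g_walk #|T|./2) /= ?last_rcons ?gxx ?euv //.
by rewrite size_rcons -[LHS]/(size (u :: v :: s)) sz even_halfK.
Qed.

End Hamilton.

(** * From Hamilton cycles to copies of the cycle graph *)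

Lemma wt_sum (T : eqType) (r : rel T) x0 x s :
  wt r x s = \sum_(i < size s) r (nth x0 (x :: s) i) (nth x0 s i).
Proof.
elim: s x => [|y s IHs] x; first by rewrite big_ord0.
by rewrite wt_cons big_ord_recl /= IHs.
Qed.

Lemma min_degree_le (G : sgraph) (x : G) : min_degree G <= degree x.
Proof.
rewrite /min_degree; have := mem_index_enum x.
elim: (index_enum _) => //= y l IHl; rewrite inE big_cons.
by case/orP=> [/eqP <-|/IHl]; [apply: geq_minl | apply/leq_trans/geq_minr].
Qed.

Lemma modn_shift_neq n i d : 0 < d < n -> i < n -> (i + d) %% n != i.
Proof.
move=> /andP[d_gt0 ltdn] ltin; rewrite -[X in _ != X](modn_small ltin).
by rewrite -[X in _ != X %% _]addn0 eqn_modDl mod0n modn_small // -lt0n.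
Qed.

(** Otherwise i and j would be successors of each other, giving i + 2 = i modulo n. *)
Lemma ordS_inj_pair n (i j : 'I_n) : 2 < n ->
  [set i; ordS i] = [set j; ordS j] -> i = j.
Proof.
move=> n_gt2 /setP eq_ij.
have := eq_ij i; rewrite !inE eqxx /= => /esym/orP[/eqP //|/eqP i_j].
have := eq_ij (ordS i); rewrite !inE eqxx orbT => /esym/orP[/eqP j_i|/eqP/ordS_inj //].
move/(congr1 val): j_i; rewrite i_j /= -addn1 modnDml addn1 -addn2 => /eqP.
by rewrite (negbTE (modn_shift_neq _ _)).
Qed.

Lemma cycle_edges n : 2 < n ->
  edges (cycle_graph n) = [set [set i; ordS i] | i : 'I_n].
Proof.
move=> n_gt2; apply/setP => E; apply/imsetP/imsetP => [[[i j] /=]|[i _ ->]].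
  rewrite inE /= => /andP[_ /orP[/eqP->|/eqP->]] ->; first by exists i.
  by exists j; rewrite // setUC.
exists (i, ordS i); rewrite // inE /= /cycle_adj eqxx andbT.
have := modn_shift_neq (ltnW n_gt2 : 0 < 1 < n) (ltn_ord i).
by rewrite addn1 eq_sym.
Qed.

Lemma even_colour_classes (G : sgraph) r (c : {set G} -> 'I_r) s :
    2 < #|G| -> ~~ odd #|G| -> r <= 2 ->
    even_hamilton (@adj G) (fun x y => c [set x; y] == 0 :> nat) s ->
  ~ odd_colouring (cycle_graph #|G|) c.
Proof.
case: s => [|x s] //= G_gt2 G_even r_le2 /and4P[path_s U /eqP sz par] odd_c.
have szE : size (rcons s x) = #|G| by rewrite size_rcons.
have {}sz : size (x :: s) = #|G| by [].
pose f (i : 'I_#|G|) := nth x (x :: s) i.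
have f_inj : injective f.
  by move=> i j /eqP; rewrite nth_uniq ?sz // => /eqP/val_inj.
have fE i : f i = nth x (x :: rcons s x) i.
  by rewrite -rcons_cons nth_rcons sz ltn_ord.
(* The appended [x] accounts for the wrap-around at the last index. *)
have fS i : f (ordS i) = nth x (rcons s x) i.
  rewrite nth_rcons /f /=; have := ltn_ord i; move: (nat_of_ord i) => k.
  rewrite -sz /= ltnS leq_eqVlt => /orP[/eqP ->|lt_k].
    by rewrite modnn ltnn eqxx.
  by rewrite modn_small // lt_k.
pose h i := [set f i; f (ordS i)].
have hE i : f @: [set i; ordS i] = h i by rewrite imsetU1 imset_set1.
have h_inj : injective h.
  move=> i j; rewrite -!hE => /(imset_inj f_inj); exact: ordS_inj_pair.
pose F := [set f @: (e : {set 'I_#|G|}) | e in edges (cycle_graph #|G|)].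
have FE : F = [set h i | i : 'I_#|G|].
  by rewrite /F cycle_edges // -imset_comp; apply: eq_imset => i /=; rewrite hE.
have card_class (P : pred {set G}) : #|[set e in F | P e]| = \sum_(i < #|G|) P (h i).
  have -> : [set e in F | P e] = h @: [set i | P (h i)].
    apply/setP => e; rewrite inE FE; apply/andP/imsetP => [[/imsetP[i _ ->] Pi]|[i]].
      by exists i; rewrite ?inE.
    by rewrite inE => Pi ->; rewrite imset_f.
  by rewrite card_imset // -sum1dep_card big_mkcond; apply: eq_bigr => i _; case: (P _).
have wtE : \sum_(i < #|G|) (c (h i) == 0 :> nat) =
    wt (fun x y => c [set x; y] == 0 :> nat) x (rcons s x).
  rewrite (wt_sum _ x) szE; apply: eq_bigr => i _.
  by rewrite /h fS fE.
have copy : is_copy (cycle_graph #|G|) (f @: setT) F.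
  split; last by exists f; split.
  apply/subsetP => e; rewrite FE => /imsetP[i _ ->].
  apply/imsetP; exists (f i, f (ordS i)) => //.
  have /(pathP x)/(_ i) := path_s; rewrite szE => /(_ (ltn_ord i)).
  by rewrite inE /= fS fE.
have [k] := odd_c _ _ copy; rewrite (card_class (fun e => c e == k)).
have ltk := ltn_ord k; case: (posnP k) => [k0|k_gt0].
  by rewrite (eq_bigr (fun i => nat_of_bool (c (h i) == 0 :> nat))) ?wtE ?(negbTE par) // => i _;
    rewrite -val_eqE /= k0.
(* A nonzero [k] must be 1, so the two classes partition the even number of edges of the cycle. *)
suff : odd (\sum_(i < #|G|) (c (h i) == k) +
            \sum_(i < #|G|) (c (h i) == 0 :> nat)) = false.
  by rewrite oddD wtE (negbTE par) addbF => ->.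
rewrite -big_split /= (eq_bigr (fun=> 1)) ?sum1_card ?card_ord ?(negbTE G_even) // => i _.
by rewrite -val_eqE /=; have := ltn_ord (c (h i)); lia.
Qed.

Theorem theorem1p3 (n : nat) (n_even : ~~ odd n) (n_ge4 : 4 <= n) :
  enat_le (Some 3) (r_odd_min n (n./2 + 4) (cycle_graph n)) /\
  (forall G : sgraph, #|G| = n -> n./2 + 4 <= min_degree G ->
     enat_le (Some 3) (r_odd G (cycle_graph n))).
Proof.
suff bound (G : sgraph) : #|G| = n -> n./2 + 4 <= min_degree G ->
    enat_le (Some 3) (r_odd G (cycle_graph n)).
  split=> //; rewrite /r_odd_min /enat_min; case: pselect => // h.
  by case: ex_minnP => k /asboolP[G [cardG degG ->]] _; apply: bound.
move=> cardG degG; rewrite /r_odd /enat_min; case: pselect => // h.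
case: ex_minnP => k /asboolP[r [[->] _ [c odd_c]]] _ /=.
rewrite ltnNge; apply/negP => r_le2.
have [|||x|||s Hs] := @exists_even_hamilton G (@adj G) _ _
  (fun x y => c [set x; y] == 0 :> nat).
- exact: adj_sym.
- exact: adj_irrefl.
- by move=> x y /=; rewrite setUC.
(* For even n, twice n/2 + 4 is n + 8. *)
- by rewrite cardG; have := leq_trans degG (min_degree_le x); rewrite /degree; lia.
- by rewrite cardG; lia.
- by rewrite cardG.
by subst n; apply: (even_colour_classes _ _ r_le2 Hs odd_c) => //; lia.
Qed.
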